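(* Let $T$ be a left-continuous t-norm, let $(V,\nu,\tau_T,\mathbf T)$ be a PN space, let $b\in\,]0,+\infty]$, and suppose $m\in M_b$ is $\tau_T$-superadditive. Let $\nu_m$ be the map defined for any $p\in V$ by $\nu_m(p):=\nu_p m$, where $\nu_p=\nu(p)$. Then the $m$-transform $(V,\nu_m,\tau_T,\mathbf T)$ is a PN space.
   Context: $\Delta^+$ is the set of distance distribution functions: nondecreasing $F:[0,+\infty]\to[0,1]$ with $F(0)=0$, $F(+\infty)=1$, left-continuous on $(0,+\infty)$, ordered pointwise and endowed with the topology of weak convergence. $\epsilon_0(x)=0$ for $x\le0$ and $1$ for $x>0$. A triangle function is a binary operation on $\Delta^+$ that is commutative, associative, nondecreasing in each argument and has $\epsilon_0$ as identity; continuity refers to weak convergence. A t-norm is a commutative, associative operation on $[0,1]$, nondecreasing in each variable, with identity $1$. For a left-continuous t-norm $T$: $\tau_T(F,G)(x)=\sup_{s+t=x}T(F(s),G(t))$ and $\mathbf T(F,G)(x)=T(F(x),G(x))$. A PN space is a quadruple $(V,\nu,\tau,\tau^* )$ where $V$ is a real linear space with null vector $\theta$, $\tau,\tau^*$ are continuous triangle functions with $\tau\le\tau^*$, and $\nu:V\to\Delta^+$, $p\mapsto\nu_p$, satisfies: (N1) $\nu_p=\epsilon_0$ iff $p=\theta$; (N2) $\nu_{-p}=\nu_p$; (N3) $\nu_{p+q}\ge\tau(\nu_p,\nu_q)$; (N4) $\nu_p\le\tau^*(\nu_{\alpha p},\nu_{(1-\alpha)p})$ for all $\alpha\in[0,1]$;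 for all $p,q\in V$. For $b\in\,]0,+\infty]$, $M_b$ is the set of continuous strictly increasing functions $m$ from $[0,b]$ onto $[0,+\infty]$. For $F\in\Delta^+$ and $m\in M_b$ with $b<+\infty$, the $m$-transform $Fm$ is $(Fm)(x)=F(m(x))$ for $x\in[0,b[$, $(Fm)(b)=\lim_{x\to b^-}F(m(x))$, $(Fm)(x)=1$ for $x>b$; if $b=+\infty$, $(Fm)(x)=F(m(x))$ for all $x\ge0$. The function $m$ is $\tau$-superadditive, for a triangle function $\tau$, if $\tau(F,G)m\ge\tau(Fm,Gm)$ for all $F,G\in\Delta^+$. *)

(* Defs.v *)
(* MathComp-Analysis: the real numbers are an arbitrary [R : realType]. *)
From HB Require Import structures.
From mathcomp Require Import all_boot all_order all_algebra.
From mathcomp Require Import all_classical all_reals all_analysis.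
From mathcomp Require Import lra.

Set Implicit Arguments.
Unset Strict Implicit.
Unset Printing Implicit Defensive.

Import Order.TTheory GRing.Theory Num.Theory.
Import numFieldNormedType.Exports.
Local Open Scope classical_set_scope.
Local Open Scope ring_scope.

(* Delta^+: a function on [0, +oo] is represented by its unique extension to   *)
(* \bar R that vanishes on the negative half-line, so that Leibniz equality of *)
(* [ddf R] is equality of functions on [0, +oo].                               *)
Record ddf (R : realType) := Ddf {
  ddf_fun :> \bar R -> R ;
  ddf_ge0_le1 : forall x, 0 <= ddf_fun x <= 1 ;
  ddf_homo : {homo ddf_fun : x y / (x <= y)%E >-> x <= y} ;
  ddf_le0 : forall x : \bar R, (x <= 0)%E -> ddf_fun x = 0 ;
  ddf_pinfty : ddf_fun +oo%E = 1 ;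
  ddf_left_continuous : forall x : R, 0 < x ->
    ddf_fun y%:E @[y --> x^'-] --> ddf_fun x%:E }.

Definition ddf_le (R : realType) (F G : ddf R) : Prop := forall x, F x <= G x.

Lemma ddf_eq (R : realType) (F G : ddf R) : F =1 G -> F = G.
Proof.
case: F G => [f f1 f2 f3 f4 f5] [g g1 g2 g3 g4 g5] /= /funext fg.
by subst g; congr Ddf; exact: Prop_irrelevance.
Qed.

Section ddf_topology.
Context (R : realType).

Definition weak_cvg (Fn : nat -> ddf R) (F : ddf R) : Prop :=
  forall x : R, {for x, continuous (fun y : R => F y%:E)} ->
    Fn n x%:E @[n --> \oo] --> F x%:E.

Definition weak_open (U : set (ddf R)) : Prop :=
  forall (Fn : nat -> ddf R) (F : ddf R), U F -> weak_cvg Fn F ->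
    \forall n \near \oo, U (Fn n).

Let weak_openT : weak_open setT.
Proof. by move=> Fn F _ _; exact: nearW. Qed.

Let weak_openI : setI_closed weak_open.
Proof.
move=> U W oU oW Fn F [UF WF] FnF.
by apply: filterI; [exact: oU UF FnF|exact: oW WF FnF].
Qed.

Let weak_open_bigU (I : Type) (f : I -> set (ddf R)) :
  (forall i, weak_open (f i)) -> weak_open (\bigcup_i f i).
Proof.
move=> of_ Fn F [i _ fiF] FnF.
by apply: filterS (of_ i Fn F fiF FnF) => n fin; exists i.
Qed.

HB.instance Definition _ := gen_eqMixin (ddf R).
HB.instance Definition _ := gen_choiceMixin (ddf R).

(* The topology of weak convergence: the finest topology for which weakly      *)
(* convergent sequences converge.  No other sequence converges, see            *)
(* [weak_cvgP] below.                                                          *)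
HB.instance Definition _ :=
  isOpenTopological.Build (ddf R) weak_openT weak_openI weak_open_bigU.

End ddf_topology.

Section left_limits.
Context (R : realType).
Implicit Types (f : R -> R) (x l : R).

Lemma cvg_at_left_homo f x l :
  (forall y z, y <= z -> z < x -> f y <= f z) ->
  (forall y, y < x -> f y <= l) ->
  (forall e, 0 < e -> exists2 y, y < x & l - e < f y) ->
  f y @[y --> x^'-] --> l.
Proof.
move=> fh fl fe; apply/cvgrPdist_lt => e e0.
have [y yx ly] := fe _ e0.
near=> z.
have zx : z < x by near: z; exact: nbhs_left_lt.
have yz : y <= z by near: z; exact: nbhs_left_ge.
have := fl _ zx; have := fh _ _ yz zx => fyz fzl.
by rewrite ger0_norm ?subr_ge0//; lra.
Unshelve. all: by end_near. Qed.

Lemma cvg_at_left_ex f x l z e : f y @[y --> x^'-] --> l -> z < x -> 0 < e ->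
  exists y, [/\ z < y, y < x & l - e < f y].
Proof.
move=> /cvgrPdist_lt fl zx e0.
have /filter_ex[y /= [[zy yx] lfy]] :
  \forall y \near x^'-, (z < y /\ y < x) /\ `|l - f y| < e.
  apply: filterI; last exact: fl.
  by apply: filterI; [exact: nbhs_left_gt|exact: nbhs_left_lt].
exists y; split => //; move: lfy; rewrite ltr_norml => /andP[_]; lra.
Qed.

End left_limits.

Section weak_convergence.
Context (R : realType).

Lemma ddf_continuity_point (F : ddf R) (y x : R) : y < x ->
  exists z, [/\ y < z, z < x & {for z, continuous (fun t : R => F t%:E)}].
Proof.
move=> yx; apply: contrapT => noz.
pose f (t : R) := F t%:E.
have fh : {homo f : s t / s <= t}.
  by move=> s t st; apply: ddf_homo; rewrite lee_fin.
have fl z : f t @[t --> z^'-] --> f z.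
  have [z0|z0] := ltP 0 z; first exact: ddf_left_continuous.
  apply: cvg_at_left_homo => [s t st _|t tz|e e0].
  - exact: fh.
  - exact/fh/ltW.
  - exists (z - 1); first lra.
    by rewrite /f !ddf_le0 ?lee_fin//; lra.
have fr z : cvg (f t @[t --> z^'+]).
  apply: nondecreasing_at_right_is_cvgr.
    by near=> t => s1 s2 _ _; exact: fh.
  by near=> t; exists 0 => _ [s _ <-]; have /andP[] := ddf_ge0_le1 F s%:E.
have disc : `]y, x[%classic `<=` [set z | z \in (`]y, x[) /\ discontinuity f z].
  move=> z yzx; split => //; split; [exact: cvgP (fl z)|exact: fr|].
  apply/eqP; rewrite (cvg_lim _ (fl z))// => fE; apply: noz; exists z.
  move: yzx; rewrite /= in_itv/= => /andP[yz zx]; split => //.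
  have := fr z; rewrite -fE => frz.
  by apply/left_right_continuousP; split; [exact: fl|exact: frz].
have : countable (`]y, x[%classic : set R).
  apply: sub_countable (discontinuity_countable (a := y) (b := x) (F := f) _).
    exact: subset_card_le.
  by move=> s t _ _; exact: fh.
move=> /countable_lebesgue_measure0; rewrite lebesgue_measure_itv/= lte_fin yx.
by move=> /eqP; rewrite -EFinB eqe subr_eq0 => /eqP xy; rewrite xy ltxx in yx.
Unshelve. all: by end_near. Qed.

Lemma weak_cvgP (Fn : nat -> ddf R) (F : ddf R) :
  Fn n @[n --> \oo] --> F <-> weak_cvg Fn F.
Proof.
split=> [FnF x Fx|FnF].
- have lo e : 0 < e -> \forall n \near \oo, F x%:E - e < Fn n x%:E.
    move=> e0.
    pose U := [set G : ddf R | exists2 y : R, y < x & F x%:E - e < G y%:E].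
    have oU : open U.
      move=> Gn G [y yx Gy] GnG.
      have [z [yz zx /GnG /cvgrPdist_lt Gz]] := ddf_continuity_point G yx.
      have d0 : 0 < G y%:E - (F x%:E - e) by rewrite subr_gt0.
      apply: filterS (Gz _ d0) => n /= Gnz; exists z => //.
      have : G y%:E <= G z%:E by apply: ddf_homo; rewrite lee_fin ltW.
      by move: Gnz; rewrite ltr_norml => /andP[_]; lra.
    have UF : U F.
      have /cvg_at_left_filter Fl := Fx.
      have x1 : x - 1 < x by lra.
      by have [y [_ yx Fy]] := cvg_at_left_ex Fl x1 e0; exists y.
    have : \forall n \near \oo, U (Fn n) by apply: FnF; exact: open_nbhs_nbhs.
    apply: filterS => n [y yx /lt_le_trans]; apply.
    by apply: ddf_homo; rewrite lee_fin ltW.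
  have hi e : 0 < e -> \forall n \near \oo, Fn n x%:E < F x%:E + e.
    move=> e0.
    pose U := [set G : ddf R | exists2 y : R, x < y & G y%:E < F x%:E + e].
    have oU : open U.
      move=> Gn G [y xy Gy] GnG.
      have [z [xz zy /GnG /cvgrPdist_lt Gz]] := ddf_continuity_point G xy.
      have d0 : 0 < F x%:E + e - G y%:E by rewrite subr_gt0.
      apply: filterS (Gz _ d0) => n /= Gnz; exists z => //.
      have : G z%:E <= G y%:E by apply: ddf_homo; rewrite lee_fin ltW.
      by move: Gnz; rewrite ltr_norml => /andP[+ _]; lra.
    have UF : U F.
      have /cvg_at_right_filter/cvgrPdist_lt/(_ _ e0) Fr := Fx.
      have /filter_ex[y [/= xy]] : \forall y \near x^'+,
          x < y /\ `|F x%:E - F y%:E| < e.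
        by apply: filterI => //; exact: nbhs_right_gt.
      by rewrite ltr_norml => /andP[? _]; exists y => //; lra.
    have : \forall n \near \oo, U (Fn n) by apply: FnF; exact: open_nbhs_nbhs.
    apply: filterS => n [y xy]; apply: le_lt_trans.
    by apply: ddf_homo; rewrite lee_fin ltW.
  apply/cvgrPdist_lt => e e0; near=> n.
  rewrite ltr_norml; apply/andP; split.
  + have : Fn n x%:E < F x%:E + e by near: n; exact: hi.
    lra.
  + have : F x%:E - e < Fn n x%:E by near: n; exact: lo.
    lra.
- by move=> A /=; rewrite nbhsE/= => -[U [oU UF] UA];
    apply: filterS (oU _ _ UF FnF) => n; exact: UA.
Unshelve. all: by end_near. Qed.

End weak_convergence.

Section eps0.
Context (R : realType).

Definition eps0_fun (x : \bar R) : R := if (x <= 0)%E then 0 else 1.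

Let eps0_ge0_le1 x : 0 <= eps0_fun x <= 1.
Proof. by rewrite /eps0_fun; case: ifP; rewrite ?lexx ler01. Qed.

Let eps0_homo : {homo eps0_fun : x y / (x <= y)%E >-> x <= y}.
Proof.
move=> x y xy; rewrite /eps0_fun; case: ifPn => x0.
  by case: ifPn; rewrite ?ler01.
by rewrite ifN// -ltNge (lt_le_trans _ xy)// ltNge.
Qed.

Let eps0_le0 (x : \bar R) : (x <= 0)%E -> eps0_fun x = 0.
Proof. by rewrite /eps0_fun => ->. Qed.

Let eps0_pinfty : eps0_fun +oo%E = 1.
Proof. by []. Qed.

Let eps0_left (x : R) : 0 < x -> eps0_fun y%:E @[y --> x^'-] --> eps0_fun x%:E.
Proof.
move=> x0; apply: cvg_at_left_homo => [y z yz _|y yx|e e0].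
- by apply: eps0_homo; rewrite lee_fin.
- by apply: eps0_homo; rewrite lee_fin ltW.
- exists (x / 2); first lra.
  by rewrite /eps0_fun !lee_fin !ifN -?ltNge; lra.
Qed.

Definition eps0 : ddf R :=
  Ddf eps0_ge0_le1 eps0_homo eps0_le0 eps0_pinfty eps0_left.

End eps0.
Arguments eps0 {R}.

Section triangle_functions.
Context (R : realType).

Record triangle_function (tau : ddf R -> ddf R -> ddf R) : Prop := {
  triangleC : commutative tau ;
  triangleA : associative tau ;
  triangle_le : forall F F' G G' : ddf R,
    ddf_le F F' -> ddf_le G G' -> ddf_le (tau F G) (tau F' G') ;
  triangle_eps0 : forall F, tau F eps0 = F }.

Definition continuous_triangle_function (tau : ddf R -> ddf R -> ddf R) : Prop :=
  triangle_function tau /\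
  continuous (fun FG : ddf R * ddf R => tau FG.1 FG.2).

End triangle_functions.

(* Left-continuous t-norms.  Only the restriction to [0, 1]^2 is meaningful;   *)
(* left-continuity is in each variable.                                        *)
Record lc_tnorm (R : realType) := LcTnorm {
  tnorm_fun :> R -> R -> R ;
  tnorm01 : forall x y : R, x \in `[0, 1] -> y \in `[0, 1] ->
    tnorm_fun x y \in `[0, 1] ;
  tnormC : {in `[0, 1] &, commutative tnorm_fun} ;
  tnormA : {in `[0, 1] & &, associative tnorm_fun} ;
  tnorm_le : {in `[0, 1] & &, forall x x' y : R, x <= x' ->
    tnorm_fun x y <= tnorm_fun x' y /\ tnorm_fun y x <= tnorm_fun y x'} ;
  tnorm1 : {in `[0, 1], forall x : R, tnorm_fun x 1 = x} ;
  tnorm_left_continuous : forall x y : R, x \in `]0, 1] -> y \in `[0, 1] ->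
    tnorm_fun z y @[z --> x^'-] --> tnorm_fun x y /\
    tnorm_fun y z @[z --> x^'-] --> tnorm_fun y x }.

Section tnorm_operations.
Context (R : realType) (T : lc_tnorm R).
Implicit Types F G : ddf R.

Let ddf01 F x : F x \in `[0, 1].
Proof. by rewrite in_itv/=; exact: ddf_ge0_le1. Qed.

Let T2le (x x' y y' : R) : x \in `[0, 1] -> x' \in `[0, 1] -> y \in `[0, 1] ->
  y' \in `[0, 1] -> x <= x' -> y <= y' -> T x y <= T x' y'.
Proof.
move=> x01 x'01 y01 y'01 xx' yy'; apply: (@le_trans _ _ (T x' y)).
  by have [] := tnorm_le T x01 x'01 y01 xx'.
by have [] := tnorm_le T y01 y'01 x'01 yy'.
Qed.

Let i01_0 : (0 : R) \in `[0, 1].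
Proof. by rewrite in_itv/= lexx ler01. Qed.

Let i01_1 : (1 : R) \in `[0, 1].
Proof. by rewrite in_itv/= lexx ler01. Qed.

Let Tge0 (x y : R) : x \in `[0, 1] -> y \in `[0, 1] -> 0 <= T x y.
Proof. by move=> x01 /(tnorm01 T x01); rewrite in_itv => /andP[]. Qed.

Let Tle1 (x y : R) : x \in `[0, 1] -> y \in `[0, 1] -> T x y <= 1.
Proof. by move=> x01 /(tnorm01 T x01); rewrite in_itv => /andP[]. Qed.

Let T0 (x : R) : x \in `[0, 1] -> T 0 x = 0.
Proof.
move=> x01; apply/eqP; rewrite eq_le Tge0// andbT -[leRHS](tnorm1 T i01_0).
by apply: T2le => //; move: x01; rewrite in_itv/= => /andP[].
Qed.

Let T_eps (x y e : R) : x \in `[0, 1] -> y \in `[0, 1] -> 0 < e ->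
  exists2 d, 0 < d & forall x' y', x' \in `[0, 1] -> y' \in `[0, 1] ->
    x - d < x' -> y - d < y' -> T x y - e < T x' y'.
Proof.
move=> x01 y01 e0.
have triv : T x y = 0 -> exists2 d, 0 < d & forall x' y',
    x' \in `[0, 1] -> y' \in `[0, 1] ->
    x - d < x' -> y - d < y' -> T x y - e < T x' y'.
  move=> ->; exists 1 => // x' y' x'01 y'01 _ _.
  by have := Tge0 x'01 y'01; lra.
have [x0|x0] := eqVneq x 0; first by apply: triv; rewrite x0 T0.
have [y0|y0] := eqVneq y 0; first by apply: triv; rewrite tnormC// y0 T0.
have {}x0 : 0 < x by rewrite lt_def x0; move: x01; rewrite in_itv => /andP[].
have {}y0 : 0 < y by rewrite lt_def y0; move: y01; rewrite in_itv => /andP[].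
have e2 : 0 < e / 2 by lra.
have xo : x \in `]0, 1] by move: x01; rewrite !in_itv/= x0 => /andP[].
have yo : y \in `]0, 1] by move: y01; rewrite !in_itv/= y0 => /andP[].
have [+ _] := tnorm_left_continuous T xo y01.
move=> Tl; have := cvg_at_left_ex Tl x0 e2 => -[x1 [x10 x1x Tx1]].
have x101 : x1 \in `[0, 1].
  by move: x01; rewrite !in_itv/= => /andP[? ?]; apply/andP; split; lra.
have [_ +] := tnorm_left_continuous T yo x101.
move=> Tl2; have := cvg_at_left_ex Tl2 y0 e2 => -[y1 [y10 y1y Ty1]].
have y101 : y1 \in `[0, 1].
  by move: y01; rewrite !in_itv/= => /andP[? ?]; apply/andP; split; lra.
exists (Num.min (x - x1) (y - y1)) => [|x' y' x'01 y'01 xx' yy'].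
  by rewrite lt_min !subr_gt0 x1x.
have : T x1 y1 <= T x' y'.
  have hx : Num.min (x - x1) (y - y1) <= x - x1 by rewrite ge_min lexx.
  have hy : Num.min (x - x1) (y - y1) <= y - y1 by rewrite ge_min lexx orbT.
  by apply: T2le => //; lra.
lra.
Qed.

Definition tauT_fun F G (x : \bar R) : R :=
  sup [set T (F st.1) (G st.2) |
       st in [set st : \bar R * \bar R |
              [/\ (0 <= st.1)%E, (0 <= st.2)%E & (st.1 + st.2)%E = x]]].

Let tau_ge F G (s t : \bar R) : (0 <= s)%E -> (0 <= t)%E ->
  T (F s) (G t) <= tauT_fun F G (s + t)%E.
Proof.
move=> s0 t0; apply: sup_upper_bound; last by exists (s, t).
split; first by exists (T (F s) (G t)), (s, t).
by exists 1 => _ [[s' t'] _ <-]; exact: Tle1.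
Qed.

Let tau_le F G (x : \bar R) (c : R) : 0 <= c ->
  (forall s t, (0 <= s)%E -> (0 <= t)%E -> (s + t)%E = x -> T (F s) (G t) <= c) ->
  tauT_fun F G x <= c.
Proof.
move=> c0 h; rewrite /tauT_fun; set A := (X in sup X).
have [->|/set0P A0] := eqVneq A set0; first by rewrite sup0.
by apply: ge_sup => // _ [[s t] /= [s0 t0 st] <-]; exact: h.
Qed.

Let tau_lt0 F G (x : \bar R) : (x < 0)%E -> tauT_fun F G x = 0.
Proof.
move=> x0; rewrite /tauT_fun; set A := (X in sup X).
suff -> : A = set0 by rewrite sup0.
rewrite -subset0 => _ [[s t] /= [s0 t0 st] _].
by move: x0; rewrite -st ltNge adde_ge0.
Qed.

Let tau_ge0_le1 F G x : 0 <= tauT_fun F G x <= 1.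
Proof.
apply/andP; split; last by apply: tau_le => // s t _ _ _; exact: Tle1.
have [/tau_lt0 ->//|x0] := ltP x 0%E.
by rewrite -[x]adde0; apply: le_trans (tau_ge _ _ x0 (lexx _)); exact: Tge0.
Qed.

Let tau_homo F G : {homo tauT_fun F G : x y / (x <= y)%E >-> x <= y}.
Proof.
move=> x y xy.
have [/(tau_lt0 F G) ->|x0] := ltP x 0%E.
  by have /andP[] := tau_ge0_le1 F G y.
apply: tau_le => [|s t s0 t0 stx]; first by have /andP[] := tau_ge0_le1 F G y.
have y0 := le_trans x0 xy.
have [s' ss' <-] : exists2 s', (s <= s')%E & (s' + t)%E = y.
  case: y {y0} xy => [y| |] xy; last by move: (le_trans x0 xy).
  - case: x x0 xy stx => [x| |]// x0 xy.
    case: s s0 => [s| |]//; case: t t0 => [t| |]// t0 s0 [stx].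
    exists (EFin (y - t : R)); last by congr EFin; rewrite subrK.
    by move: xy; rewrite !lee_fin; lra.
  - exists +oo%E; first exact: leey.
    by case: t t0 {stx}.
apply: le_trans (tau_ge _ _ (le_trans s0 ss') t0).
by apply: T2le => //; exact: ddf_homo.
Qed.

Let tau_le0 F G (x : \bar R) : (x <= 0)%E -> tauT_fun F G x = 0.
Proof.
move=> x0; apply/eqP; rewrite eq_le; apply/andP; split; last first.
  by have /andP[] := tau_ge0_le1 F G x.
apply: tau_le => // s t s0 t0 stx.
rewrite (@ddf_le0 _ F s) ?T0//.
by apply: le_trans x0; rewrite -stx leeDl.
Qed.

Let tau_pinfty F G : tauT_fun F G +oo%E = 1.
Proof.
apply/eqP; rewrite eq_le; have /andP[_ ->] /= := tau_ge0_le1 F G +oo%E.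
apply: le_trans (tau_ge F G (leey 0) (leey 0)).
by rewrite !ddf_pinfty tnorm1.
Qed.

Let tau_left F G (x : R) : 0 < x ->
  tauT_fun F G y%:E @[y --> x^'-] --> tauT_fun F G x%:E.
Proof.
move=> x0; apply: cvg_at_left_homo => [y z yz _|y yx|e e0].
- by apply: tau_homo; rewrite lee_fin.
- by apply: tau_homo; rewrite lee_fin ltW.
set S := tauT_fun F G x%:E.
have [S0|S0] := leP 0 (S - e); last first.
  exists (x / 2); first lra.
  by apply: lt_le_trans S0 _; have /andP[] := tau_ge0_le1 F G (x / 2)%:E.
have [s [t [s0 t0 stx Tst]]] : exists s t : R,
    [/\ 0 <= s, 0 <= t, s + t = x & S - e < T (F s%:E) (G t%:E)].
  apply: contrapT => nst.
  suff : S <= S - e by lra.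
  apply: tau_le => // -[s| |] [t| |]//= s0 t0 [stx].
  by rewrite leNgt; apply/negP => h; apply: nst; exists s, t.
have {}s0 : 0 < s.
  rewrite lt_def s0 andbT; apply/eqP => sE; move: Tst.
  by rewrite (@ddf_le0 _ F) ?sE ?lexx// T0//; lra.
have {}t0 : 0 < t.
  rewrite lt_def t0 andbT; apply/eqP => tE; move: Tst.
  by rewrite (@ddf_le0 _ G) ?tE ?lexx// tnormC// T0//; lra.
have e'0 : 0 < T (F s%:E) (G t%:E) - (S - e) by rewrite subr_gt0.
have [d d0 hd] := T_eps (ddf01 F s%:E) (ddf01 G t%:E) e'0.
have [s' [s'0 s's Fs']] := cvg_at_left_ex (@ddf_left_continuous _ F _ s0) s0 d0.
have [t' [t'0 t't Gt']] := cvg_at_left_ex (@ddf_left_continuous _ G _ t0) t0 d0.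
exists (s' + t'); first lra.
have := hd _ _ (ddf01 F s'%:E) (ddf01 G t'%:E) Fs' Gt'.
have := @tau_ge F G s'%:E t'%:E; rewrite !lee_fin -EFinD.
move=> /(_ (ltW s'0) (ltW t'0)); lra.
Qed.

Definition tauT F G : ddf R :=
  Ddf (tau_ge0_le1 F G) (@tau_homo F G) (@tau_le0 F G) (tau_pinfty F G)
      (@tau_left F G).

Definition boldT_fun F G (x : \bar R) : R := T (F x) (G x).

Let pw_ge0_le1 F G x : 0 <= boldT_fun F G x <= 1.
Proof. by rewrite Tge0 ?Tle1. Qed.

Let pw_homo F G : {homo boldT_fun F G : x y / (x <= y)%E >-> x <= y}.
Proof. by move=> x y xy; apply: T2le => //; exact: ddf_homo. Qed.

Let pw_le0 F G (x : \bar R) : (x <= 0)%E -> boldT_fun F G x = 0.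
Proof. by move=> x0; rewrite /boldT_fun !(ddf_le0 _ x0) T0. Qed.

Let pw_pinfty F G : boldT_fun F G +oo%E = 1.
Proof. by rewrite /boldT_fun !ddf_pinfty tnorm1. Qed.

Let pw_left F G (x : R) : 0 < x ->
  boldT_fun F G y%:E @[y --> x^'-] --> boldT_fun F G x%:E.
Proof.
move=> x0; apply: cvg_at_left_homo => [y z yz _|y yx|e e0].
- by apply: pw_homo; rewrite lee_fin.
- by apply: pw_homo; rewrite lee_fin ltW.
have [d d0 hd] := T_eps (ddf01 F x%:E) (ddf01 G x%:E) e0.
have [s [s0 sx Fs]] := cvg_at_left_ex (@ddf_left_continuous _ F _ x0) x0 d0.
have [t [t0 tx Gt]] := cvg_at_left_ex (@ddf_left_continuous _ G _ x0) x0 d0.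
exists (Num.max s t); first by rewrite gt_max sx.
apply: hd => //; apply: lt_le_trans; try eassumption.
  by apply: ddf_homo; rewrite lee_fin le_max lexx.
by apply: ddf_homo; rewrite lee_fin le_max lexx orbT.
Qed.

Definition boldT F G : ddf R :=
  Ddf (pw_ge0_le1 F G) (@pw_homo F G) (@pw_le0 F G) (pw_pinfty F G)
      (@pw_left F G).

End tnorm_operations.

Record pn_space (R : realType) (V : lmodType R) (nu : V -> ddf R)
    (tau taus : ddf R -> ddf R -> ddf R) : Prop := {
  pn_tau : continuous_triangle_function tau ;
  pn_taus : continuous_triangle_function taus ;
  pn_tau_le : forall F G, ddf_le (tau F G) (taus F G) ;
  pn_N1 : forall p, nu p = eps0 <-> p = 0 ;
  pn_N2 : forall p, nu (- p) = nu p ;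
  pn_N3 : forall p q, ddf_le (tau (nu p) (nu q)) (nu (p + q)) ;
  pn_N4 : forall (a : R) p, 0 <= a <= 1 ->
    ddf_le (nu p) (taus (nu (a *: p)) (nu ((1 - a) *: p))) }.

(* M_b.  Only the restriction of the function to [0, b] is meaningful. *)
Record mclass (R : realType) (b : \bar R) := MClass {
  mclass_fun :> \bar R -> \bar R ;
  mclass_continuous : {within [set` `[0%E, b]], continuous mclass_fun} ;
  mclass_increasing :
    {in `[0%E, b] &, {homo mclass_fun : x y / (x < y)%E}} ;
  mclass_onto : mclass_fun @` [set` `[0%E, b]] = [set` `[0%E, +oo%E]] }.

(* Value 0 on the negative half-line is the convention of [ddf]; the wildcard  *)
(* branch is b = +oo, since [mclass b] forces b > 0.                           *)
Definition mtransform_fun (R : realType) (b : \bar R) (m : \bar R -> \bar R)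
    (F : ddf R) (x : \bar R) : R :=
  if (x < 0)%E then 0 else
  match b with
  | r%:E => if (x < r%:E)%E then F (m x)
            else if x == r%:E then lim (F (m y%:E) @[y --> r^'-])
            else 1
  | _ => F (m x)
  end.

Section m_transform.
Context (R : realType) (b : \bar R) (m : mclass b).
Implicit Type F : ddf R.

Let m_mono : {in `[0%E, b] &, {mono m : x y / (x <= y)%E}}.
Proof. exact: le_mono_in (@mclass_increasing _ _ m). Qed.

Let m_mono_lt : {in `[0%E, b] &, {mono m : x y / (x < y)%E}}.
Proof. exact: leW_mono_in m_mono. Qed.

Let m_ge0 (x : \bar R) : (0 <= x <= b)%E -> (0 <= m x)%E.
Proof.
move=> x0b; have : [set` `[0%E, +oo%E]] (m x).
  by rewrite -(mclass_onto m); exists x => //=; rewrite in_itv.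
by rewrite /= in_itv/= => /andP[].
Qed.

Let m_ex (y : \bar R) : (0 <= y)%E -> exists2 x, (0 <= x <= b)%E & m x = y.
Proof.
move=> y0; have : [set` `[0%E, +oo%E]] y by rewrite /= in_itv/= y0 leey.
by rewrite -(mclass_onto m) => -[x /= + <-]; rewrite in_itv/= => xb; exists x.
Qed.

Let b_ge0 : (0 <= b)%E.
Proof. by have [x /andP[x0 xb] _] := m_ex (lexx 0%E); exact: le_trans xb. Qed.

Let m0 : m 0%E = 0%E.
Proof.
have [x xb mx] := m_ex (lexx 0%E).
have : (m 0 <= m x)%E.
  by rewrite m_mono ?in_itv/= ?lexx ?b_ge0//; case/andP: xb.
by rewrite mx => h; apply/eqP; rewrite eq_le h m_ge0// lexx b_ge0.
Qed.

Let mb : m b = +oo%E.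
Proof.
have [x xb mx] := m_ex (leey 0%E).
have : (m x <= m b)%E.
  by rewrite m_mono ?in_itv/= ?lexx ?b_ge0//; case/andP: xb.
by rewrite mx leye_eq => /eqP.
Qed.

Let b_gt0 : (0 < b)%E.
Proof.
rewrite lt_def b_ge0 andbT; apply/eqP => b0.
by have := mb; rewrite [X in m X]b0 m0.
Qed.

Let b_case : (exists2 r : R, b = r%:E & 0 < r) \/ b = +oo%E.
Proof.
have := b_gt0; case Eb : b => [r| |]// r0; [left|by right].
by exists r; rewrite ?lte_fin in r0 *.
Qed.

Let mt_b_fin F r : b = r%:E -> 0 < r ->
  mtransform_fun b m F b = lim (F (m y%:E) @[y --> r^'-]).
Proof.
rewrite /mtransform_fun; move: (mclass_fun m) => f -> r0.
by rewrite lte_fin ltNge ltW//= ltxx eqxx.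
Qed.

Let mt_b_oo F : b = +oo%E -> mtransform_fun b m F b = 1.
Proof.
rewrite /mtransform_fun; have := mb; move: (mclass_fun m) => f + boo.
by rewrite boo /= => ->; rewrite ddf_pinfty.
Qed.

Let mtE F x : mtransform_fun b m F x = if (x < 0)%E then 0 else
  if (x < b)%E then F (m x) else
  if x == b then mtransform_fun b m F b else 1.
Proof.
have [->|xb] := eqVneq x b; first by rewrite ltNge b_ge0 ltxx.
rewrite /mtransform_fun; case: ifP => // _; move: xb.
move: (mclass_fun m) => f; have := b_gt0; case: b => [r| |]//= _.
  by move=> /negbTE ->.
by rewrite lt_neqAle leey andbT => ->.
Qed.

Let mt_lt F x : (0 <= x)%E -> (x < b)%E -> mtransform_fun b m F x = F (m x).
Proof. by move=> x0 xb; rewrite mtE ltNge x0/= xb. Qed.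

Let mt_cvg F r : b = r%:E -> cvg (F (m y%:E) @[y --> r^'-]).
Proof.
move=> br; apply: nondecreasing_at_left_is_cvgr.
  near=> z => s t; rewrite !in_itv/= => /andP[zs sr] /andP[zt tr] st.
  have z0 : 0 <= z.
    by near: z; apply: nbhs_left_ge; move: b_gt0; rewrite br lte_fin.
  apply: ddf_homo; rewrite m_mono ?in_itv/= ?lee_fin//.
    by rewrite [X in (_ <= X)%E]br !lee_fin; apply/andP; split; lra.
  by rewrite [X in (_ <= X)%E]br !lee_fin; apply/andP; split; lra.
by near=> z; exists 1 => _ [t _ <-]; have /andP[] := ddf_ge0_le1 F (m t%:E).
Unshelve. all: by end_near. Qed.

Let mt_ge0_le1 F x : 0 <= mtransform_fun b m F x <= 1.
Proof.
rewrite mtE; case: ifP => _; first by rewrite lexx ler01.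
case: ifP => _; first exact: ddf_ge0_le1.
case: ifP => _; last by rewrite lexx ler01.
case: b_case => [[r br r0]|/mt_b_oo ->]; last by rewrite lexx ler01.
have h := @mt_cvg F r br.
rewrite (@mt_b_fin F r br r0); apply/andP; split.
  apply: limr_ge; first exact: h.
  by near=> y; have /andP[] := ddf_ge0_le1 F (m y%:E).
apply: limr_le; first exact: h.
by near=> y; have /andP[] := ddf_ge0_le1 F (m y%:E).
Unshelve. all: by end_near. Qed.

Let mt_homo F : {homo mtransform_fun b m F : x y / (x <= y)%E >-> x <= y}.
Proof.
move=> x y xy; have [x0|x0] := ltP x 0%E.
  by rewrite {1}mtE x0; have /andP[] := mt_ge0_le1 F y.
have y0 := le_trans x0 xy.
have [yb|yb] := ltP y b.
  have xb := le_lt_trans xy yb.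
  rewrite !mt_lt//; apply: ddf_homo.
  by rewrite m_mono// in_itv/= ?x0 ?y0 ltW.
have [xb|xb] := ltP x b; last first.
  have [yE|yb'] := eqVneq y b.
    by have -> : x = y by apply/eqP; rewrite eq_le xy yE xb.
  have yE : mtransform_fun b m F y = 1.
    by rewrite mtE ltNge y0/= ltNge yb/= (negbTE yb').
  by rewrite yE; have /andP[] := mt_ge0_le1 F x.
rewrite [leRHS]mtE ltNge y0/= ltNge yb/=.
case: ifP => _; last by have /andP[] := mt_ge0_le1 F x.
case: b_case => [[r br r0]|/(mt_b_oo F) ->]; last first.
  by have /andP[] := mt_ge0_le1 F x.
rewrite (@mt_b_fin F r br r0) mt_lt//.
move: x x0 xb {xy} => [x| |]//; last by move=> _; rewrite ltNge leey.
rewrite lee_fin [X in (_ < X)%E]br lte_fin => x0 xr.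
apply: limr_ge; first exact: (@mt_cvg F r br).
near=> z.
have xz : x <= z by near: z; exact: nbhs_left_ge.
have zr : z <= r by near: z; exact: nbhs_left_le.
apply: ddf_homo; rewrite m_mono ?in_itv/= ?lee_fin//.
  by rewrite [X in (_ <= X)%E]br !lee_fin; apply/andP; split; lra.
by rewrite [X in (_ <= X)%E]br !lee_fin; apply/andP; split; lra.
Unshelve. all: by end_near. Qed.

Let mt_le0 F (x : \bar R) : (x <= 0)%E -> mtransform_fun b m F x = 0.
Proof.
rewrite le_eqVlt => /predU1P[->|x0]; last by rewrite mtE x0.
by rewrite mt_lt// m0 ddf_le0.
Qed.

Let mt_pinfty F : mtransform_fun b m F +oo%E = 1.
Proof. 
rewrite mtE/= ltNge leey/=; case: ifP => // /eqP/esym; exact: mt_b_oo.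
 Qed.

Let mt_left F (x : R) : 0 < x ->
  mtransform_fun b m F y%:E @[y --> x^'-] --> mtransform_fun b m F x%:E.
Proof.
move=> x0; apply: cvg_at_left_homo => [y z yz _|y yx|e e0].
- by apply: mt_homo; rewrite lee_fin.
- by apply: mt_homo; rewrite lee_fin ltW.
have [xb|bx] := ltP x%:E b.
  have x0b : x%:E \in `[0%E, b] by rewrite in_itv/= lee_fin !ltW.
  have bb : b \in `[0%E, b] by rewrite in_itv/= lexx b_ge0.
  have ob : 0%E \in `[0%E, b] by rewrite in_itv/= lexx b_ge0.
  have mx0 : (0 < m x%:E)%E by rewrite -m0 m_mono_lt// lte_fin.
  have mxoo : (m x%:E < +oo)%E by rewrite -mb m_mono_lt.
  rewrite [X in X - _]mt_lt//; last by rewrite lee_fin ltW.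
  case Em : (m x%:E) mx0 mxoo => [a| |]//; rewrite lte_fin => a0 _.
  have [z [z0 za Fz]] := cvg_at_left_ex (@ddf_left_continuous _ F _ a0) a0 e0.
  have [y yb my] := m_ex (ltW z0 : (0 <= z%:E)%E).
  have yx : (y < x%:E)%E by rewrite -m_mono_lt ?in_itv// my Em lte_fin.
  have /andP[y0 _] := yb.
  case: y y0 yx yb my => [y| |]// y0 yx yb my.
  by exists y => //; rewrite mt_lt ?my// (lt_trans yx).
case: b_case => [[r br r0]|boo]; last by rewrite [b in (b <= _)%E]boo in bx.
have [xr|xr] := eqVneq x r.
  have -> : mtransform_fun b m F x%:E = lim (F (m y%:E) @[y --> r^'-]).
    by rewrite xr -(@mt_b_fin F r br r0) -[X in mtransform_fun b m F X = _]br.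
  have [y [y0 yr Fy]] := cvg_at_left_ex (@mt_cvg F r br : _ --> _) r0 e0.
  exists y; first by rewrite xr.
  by rewrite mt_lt ?lee_fin ?ltW//; rewrite [X in (_ < X)%E]br lte_fin.
have rx : r < x by rewrite lt_def xr; move: bx; rewrite [X in (X <= _)%E]br lee_fin.
exists ((x + r) / 2); first lra.
have /andP[_ le1] := mt_ge0_le1 F x%:E.
suff -> : mtransform_fun b m F ((x + r) / 2)%:E = 1 by lra.
rewrite mtE ltNge lee_fin (_ : 0 <= _); last lra.
have rxr : r < (x + r) / 2 by lra.
by rewrite ltNge [X in (X <= _)%E]br lee_fin ltW//= [X in _ == X]br eqe gt_eqF.
Qed.

Definition mtransform F : ddf R :=
  Ddf (mt_ge0_le1 F) (@mt_homo F) (@mt_le0 F) (mt_pinfty F) (@mt_left F).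

End m_transform.

Definition tau_superadditive (R : realType) (b : \bar R) (m : mclass b)
    (tau : ddf R -> ddf R -> ddf R) : Prop :=
  forall F G, ddf_le (tau (mtransform m F) (mtransform m G))
                     (mtransform m (tau F G)).

(* Main.v *)
(* Inequalities between m-transforms need only be checked on ]0, b[, where     *)
(* (Fm)(x) = F(m(x)): left-continuity extends them to b, and Fm = 1 beyond b.  *)
(* Hence F |-> Fm is nondecreasing and T(F, G)m <= T(Fm, Gm) pointwise, which  *)
(* transports (N4); superadditivity transports (N3).  Since m restricts to a   *)
(* bijection from ]0, b[ to ]0, +oo[, Fm = eps0 exactly when F = eps0.         *)
Require Import Defs.
From mathcomp Require Import all_boot all_order all_algebra.
From mathcomp Require Import all_classical all_reals all_analysis.

Set Implicit Arguments.
Unset Strict Implicit.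
Unset Printing Implicit Defensive.

Import Order.TTheory GRing.Theory Num.Theory.
Import numFieldNormedType.Exports.
Local Open Scope classical_set_scope.
Local Open Scope ring_scope.

(** The conditions on the triangle functions alone do not involve [nu] and are inherited. (N1) is
    [mtransform_eps0]. (N3) is the chain tau_T(Fm, Gm) <= tau_T(F, G)m <= Hm with F, G, H the values
    of [nu] at p, q, p + q: superadditivity, then [mtransform_homo]. (N4) is the dual chain,
    [mtransform_homo] followed by [mtransform_boldT]. Both lemmas come from [mtransform_le]. *)

Lemma ddf_ge0 (R : realType) (F : ddf R) x : 0 <= F x.
Proof. by have /andP[] := ddf_ge0_le1 F x. Qed.

Lemma ddf_le1 (R : realType) (F : ddf R) x : F x <= 1.
Proof. by have /andP[] := ddf_ge0_le1 F x. Qed.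

Lemma ddf_le_trans (R : realType) (F G H : ddf R) :
  ddf_le F G -> ddf_le G H -> ddf_le F H.
Proof. by move=> FG GH x; exact: le_trans (FG x) (GH x). Qed.

Lemma ddf_le_anti (R : realType) (F G : ddf R) :
  ddf_le F G -> ddf_le G F -> F = G.
Proof.
by move=> FG GF; apply: ddf_eq => x; apply/eqP; rewrite eq_le FG GF.
Qed.

Lemma ddf_le_eps0 (R : realType) (F : ddf R) : ddf_le F eps0.
Proof.
move=> x; rewrite /= /eps0_fun; case: ifP => [x0|_]; first by rewrite ddf_le0.
exact: ddf_le1.
Qed.

Lemma eps0_le_ddf (R : realType) (F : ddf R) :
  (forall x, (0 < x)%E -> F x = 1) -> ddf_le eps0 F.
Proof.
move=> F1 x; rewrite /= /eps0_fun; case: ifPn => [_|]; first exact: ddf_ge0.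
by rewrite -ltNge => /F1 ->.
Qed.

(** At a finite [b] both values are left limits, and limits preserve <=; at +oo both are 1. This
    spares any computation with the limit that defines Fm at [b]. *)
Lemma ddf_le_left (R : realType) (F G : ddf R) (b : \bar R) : (0 < b)%E ->
  (forall x, (0 < x < b)%E -> F x <= G x) -> F b <= G b.
Proof.
case: b => [r| |]// r0 FG; last by rewrite !ddf_pinfty.
rewrite lte_fin in r0.
have Fl := @ddf_left_continuous _ F _ r0.
have Gl := @ddf_left_continuous _ G _ r0.
rewrite -(cvg_lim _ Fl)// -(cvg_lim _ Gl)//.
apply: ler_lim; [exact: cvgP Fl|exact: cvgP Gl|].
near=> y; apply: FG; rewrite !lte_fin; apply/andP; split.
  by near: y; exact: nbhs_left_gt.
by near: y; exact: nbhs_left_lt.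
Unshelve. all: by end_near. Qed.

Section mtransform_theory.
Context (R : realType) (b : \bar R) (b0 : (0 < b)%E) (m : mclass b).
Implicit Types F G : ddf R.

Lemma mclass_ge0 x : (0 <= x <= b)%E -> (0 <= m x)%E.
Proof.
move=> xb; have : [set` `[0%E, +oo%E]] (m x).
  by rewrite -(mclass_onto m); exists x => //=; rewrite in_itv.
by rewrite /= in_itv/= => /andP[].
Qed.

Lemma mclass_gt0 x : (0 < x < b)%E -> (0 < m x)%E.
Proof.
move=> /andP[x0 xb]; apply: (@le_lt_trans _ _ (m 0%E)).
  by rewrite mclass_ge0// lexx ltW.
by apply: mclass_increasing; rewrite ?in_itv//= ?lexx ?ltW.
Qed.

Lemma mclass_surj y : (0 < y < +oo)%E -> exists2 x, (0 < x < b)%E & m x = y.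
Proof.
have surj z : (0 <= z)%E -> exists2 x, x \in `[0%E, b] & m x = z.
  move=> z0; have : [set` `[0%E, +oo%E]] z by rewrite /= in_itv/= z0 leey.
  by rewrite -(mclass_onto m) => -[x xb mx]; exists x.
have mono : {in `[0%E, b] &, {mono m : x z / (x < z)%E}}.
  exact: leW_mono_in (le_mono_in (@mclass_increasing _ _ m)).
move=> /andP[y0 yoo].
have [x xb mx] := surj _ (ltW y0).
(* Comparing [x] with preimages [u] of 0 and [v] of +oo keeps it off the endpoints. *)
have [u ub mu] := surj _ (lexx 0%E).
have [v vb mv] := surj _ (leey 0%E).
exists x => //; apply/andP; split.
  have ux : (u < x)%E by rewrite -mono// mu mx.
  by apply: le_lt_trans ux; move: ub; rewrite in_itv => /andP[].
have xv : (x < v)%E by rewrite -mono// mv mx.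
by apply: lt_le_trans xv _; move: vb; rewrite in_itv => /andP[].
Qed.

Lemma mtransform_lt F x : (0 < x < b)%E -> mtransform m F x = F (m x).
Proof.
move=> /andP[x0 xb]; rewrite /= /mtransform_fun ltNge ltW//=.
(* The type of [m] depends on [b], so its function is generalized before the case analysis. *)
by move: (mclass_fun m) xb; case: b b0 => [r| |]// _ f ->.
Qed.

Lemma mtransform_gt F x : (b < x)%E -> mtransform m F x = 1.
Proof.
move=> bx; have x0 := lt_trans b0 bx.
rewrite /= /mtransform_fun ltNge ltW//=.
move: (mclass_fun m) bx; case: b b0 => [r| |]// _ f rx.
  by rewrite ltNge ltW//= gt_eqF.
by move: rx; rewrite ltNge leey.
Qed.

Lemma mtransform_le F G : (forall x, (0 < x < b)%E -> F (m x) <= G x) ->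
  (forall x, (b < x)%E -> G x = 1) -> ddf_le (mtransform m F) G.
Proof.
move=> FG G1.
have FG' x : (0 < x < b)%E -> mtransform m F x <= G x.
  by move=> xb; rewrite mtransform_lt//; exact: FG.
move=> x; have [x0|x0] := leP x 0%E; first by rewrite ddf_le0// ddf_ge0.
have [xb|bx|->] := ltgtP x b.
- by apply: FG'; rewrite x0.
- by rewrite G1// ddf_le1.
- exact: ddf_le_left.
Qed.

Lemma mtransform_homo F G : ddf_le F G ->
  ddf_le (mtransform m F) (mtransform m G).
Proof.
move=> FG; apply: mtransform_le => x xb; last exact: mtransform_gt.
by rewrite mtransform_lt.
Qed.

(** As [eps0] is the largest element, it suffices to find the value 1 at every positive point. *)
Lemma mtransform_eps0 F : mtransform m F = eps0 <-> F = eps0.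
Proof.
split=> [Fm|->]; apply: ddf_le_anti; try exact: ddf_le_eps0.
  apply: eps0_le_ddf => y y0.
  have [yoo|] := ltP y +oo%E; last first.
    by rewrite leye_eq => /eqP ->; exact: ddf_pinfty.
  have [|x xb <-] := @mclass_surj y; first by rewrite y0.
  rewrite -mtransform_lt// Fm /= /eps0_fun ifN// -ltNge.
  by case/andP: xb.
have mt1 x : (0 < x < b)%E -> mtransform m eps0 x = 1.
  move=> xb; rewrite mtransform_lt//= /eps0_fun ifN// -ltNge.
  exact: mclass_gt0.
apply: eps0_le_ddf => x x0; have [xb|bx] := ltP x b; first by rewrite mt1// x0.
(* The preimage of 1 is just some point of ]0, b[; the transform is 1 there, hence also at [x] by
   monotonicity. *)
have [|y yb _] := @mclass_surj 1%E; first by rewrite lte01 ltry.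
apply/eqP; rewrite eq_le ddf_le1 -(mt1 y)//; apply: ddf_homo.
by case/andP: yb => _ /ltW yb; exact: le_trans bx.
Qed.

Lemma mtransform_boldT (T : lc_tnorm R) F G :
  ddf_le (mtransform m (boldT T F G))
         (boldT T (mtransform m F) (mtransform m G)).
Proof.
apply: mtransform_le => x xb.
  by rewrite {2}/boldT [leRHS]/= /boldT_fun !mtransform_lt.
rewrite {1}/boldT [LHS]/= /boldT_fun !mtransform_gt// tnorm1//.
by rewrite in_itv/= ler01 lexx.
Qed.

End mtransform_theory.

Theorem theorem9 (R : realType) (T : lc_tnorm R) (V : lmodType R)
    (nu : V -> ddf R) (hV : pn_space nu (tauT T) (boldT T))
    (b : \bar R) (hb : (0 < b)%E) (m : mclass b)
    (hm : tau_superadditive m (tauT T)) :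
  pn_space (fun p : V => mtransform m (nu p)) (tauT T) (boldT T).
Proof.
case: hV => ctau cT tauT_le N1 N2 N3 N4; split => //.
- by move=> p; rewrite mtransform_eps0.
- by move=> p; rewrite N2.
- move=> p q; apply: ddf_le_trans (hm _ _) _.
  exact: mtransform_homo.
- move=> a p a01; apply: ddf_le_trans (mtransform_boldT hb m T _ _).
  exact/mtransform_homo/N4.
Qed.
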